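(* Let $\xi(x,y)=\max(x,y,0)$, and assume the feature matrix $\mathbf{F}\in\mathbb{R}^{M\times M}$ of the templates $\mathbb{X}$ is invertible. Let $\mathcal{H}\in\mathbb{R}^{M\times M\times\cdots\times M}$ be an arbitrary tensor of order $T$. Then there exist a generalized shallow network with $\xi$-nonlinearity (of some width) and a generalized RNN with $\xi$-nonlinearity (of some size $L$ and ranks $R_1,\dots,R_{T-1}$) such that the grid tensor $\boldsymbol{\Gamma}^{\ell}(\mathbb{X})$ of each of the two networks equals $\mathcal{H}$.
   Context: Fix positive integers $N,M$ and $T\ge 2$, a feature map $f_\theta:\mathbb{R}^N\to\mathbb{R}^M$, and template vectors $\mathbb{X}=\{\mathbf{x}^{(1)},\dots,\mathbf{x}^{(M)}\}\subset\mathbb{R}^N$. An input is a sequence $X=(\mathbf{y}^{(1)},\dots,\mathbf{y}^{(T)})$ with $\mathbf{y}^{(t)}\in\mathbb{R}^N$. The feature matrix $\mathbf{F}\in\mathbb{R}^{M\times M}$ is the matrix whose $i$-th row is $f_\theta(\mathbf{x}^{(i)})^\top$. $\xi:\mathbb{R}\times\mathbb{R}\to\mathbb{R}$ is an associative and commutative binary operator, extended to any number of operands by associativity (for $\xi(x,y)=\max(x,y,0)$: $\xi(x_1,\dots,x_n)=\max(x_1,\dots,x_n,0)$). A generalized shallow network of width (rank) $R$ with $\xi$-nonlinearity has parameters $\lambda_r\in\mathbb{R}$, $\mathbf{v}_r^{(t)}\in\mathbb{R}^M$ ($1\le r\le R$, $1\le t\le T$) and score function $\ell(X)=\sum_{r=1}^R\lambda_r\,\xi\big(\langle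 f_\theta(\mathbf{y}^{(1)}),\mathbf{v}_r^{(1)}\rangle,\dots,\langle f_\theta(\mathbf{y}^{(T)}),\mathbf{v}_r^{(T)}\rangle\big)$. A generalized RNN with $\xi$-nonlinearity, with ranks $R_1,\dots,R_{T-1}$ (and $R_0=R_T=1$), has parameters $\mathbf{C}^{(t)}\in\mathbb{R}^{L\times M}$ and $\mathcal{G}^{(t)}\in\mathbb{R}^{L\times R_{t-1}\times R_t}$, $t=1,\dots,T$, for some positive integer $L$. Its hidden states $\mathbf{h}^{(t)}\in\mathbb{R}^{R_t}$ are $\mathbf{h}^{(t)}_k=\sum_{i,j}\mathcal{G}^{(t)}_{ijk}\,\xi\big([\mathbf{C}^{(t)}f_\theta(\mathbf{y}^{(t)})]_i,\mathbf{h}^{(t-1)}_j\big)$, with initial state $\mathbf{h}^{(0)}=u\in\mathbb{R}^1$, where $u$ is a unit of $\xi$, i.e. $\xi(x,y,u)=\xi(x,y)$ for all $x,y\in\mathbb{R}$ (for $\xi(x,y)=\max(x,y,0)$ one takes $u=0$). Its score function is $\ell(X)=\mathbf{h}^{(T)}\in\mathbb{R}^1$. The grid tensor of a score function $\ell$ is the order-$T$ tensor $\boldsymbol{\Gamma}^{\ell}(\mathbb{X})\in\mathbb{R}^{M\times\cdots\times M}$ with entries $\boldsymbol{\Gamma}^{\ell}(\mathbb{X})_{i_1\dots i_T}=\ell\big((\mathbf{x}^{(i_1)},\dots,\mathbf{x}^{(i_T)})\big)$, $i_1,\dots,i_T\in\{1,\dots,M\}$. *)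

(* Defs.v *)
From HB Require Import structures.
From mathcomp Require Import all_boot all_order all_algebra.
From mathcomp Require Import reals.

Set Implicit Arguments.
Unset Strict Implicit.
Unset Printing Implicit Defensive.

Import Order.TTheory GRing.Theory Num.Theory.
Local Open Scope ring_scope.

Definition relu_xi (R : realType) (x y : R) : R := Num.max (Num.max x y) 0.

(* [xi] extended to n >= 1 operands by associativity; one operand gives the
   operand itself, and the value on the empty sequence is never used. *)
Definition nary (R : realType) (xi : R -> R -> R) (s : seq R) : R :=
  if s is a :: s' then foldl xi a s' else 0.

Lemma relu_xiA (R : realType) : associative (@relu_xi R).
Proof.
move=> x y z; rewrite /relu_xi !maxA; congr Num.max.
exact: maxAC.
Qed.

Lemma relu_xiC (R : realType) : commutative (@relu_xi R).
Proof. by move=> x y; rewrite /relu_xi maxC (maxC x) maxC. Qed.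

Lemma relu_xi_unit (R : realType) (x y : R) :
  nary (@relu_xi R) [:: x; y; 0] = nary (@relu_xi R) [:: x; y].
Proof. by rewrite /= /relu_xi -(maxA _ 0 0) maxxx -(maxA _ 0 0) maxxx. Qed.

Lemma nary_relu_xi (R : realType) (s : seq R) : (1 < size s)%N ->
  nary (@relu_xi R) s = \big[Num.max/0]_(a <- s) a.
Proof.
have aux (s' : seq R) (a : R) :
    foldl (@relu_xi R) (Num.max a 0) s' =
    Num.max a (\big[Num.max/0]_(b <- s') b).
  elim: s' a => [|b s' IH] a /=; first by rewrite big_nil.
  have -> : relu_xi (Num.max a 0) b = Num.max (Num.max a b) 0.
    by rewrite /relu_xi (maxAC a 0 b) -(maxA _ 0 0) maxxx.
  by rewrite IH big_cons maxA.
case: s => [|a [|b s]] //= _.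
by rewrite {2}/relu_xi aux !big_cons maxA.
Qed.

Definition inner (R : realType) (M : nat) (a b : 'cV[R]_M) : R :=
  (a^T *m b) 0 0.

Definition feature_matrix (R : realType) (N M : nat)
    (f : 'cV[R]_N -> 'cV[R]_M) (x : 'I_M -> 'cV[R]_N) : 'M[R]_M :=
  \matrix_(i < M, j < M) f (x i) j 0.

(* Order-T tensors with all dimensions equal to M. *)
Definition tensor (R : realType) (M T : nat) : Type :=
  {ffun T.-tuple 'I_M -> R}.

Definition grid_tensor (R : realType) (N M T : nat) (x : 'I_M -> 'cV[R]_N)
    (score : T.-tuple 'cV[R]_N -> R) : tensor R M T :=
  [ffun i : T.-tuple 'I_M => score [tuple x (tnth i t) | t < T]].

Record shallow_net (R : realType) (M T W : nat) := ShallowNet {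
  sh_lambda : 'I_W -> R;
  sh_v : 'I_W -> 'I_T -> 'cV[R]_M
}.

Definition shallow_score (R : realType) (xi : R -> R -> R) (N M T W : nat)
    (f : 'cV[R]_N -> 'cV[R]_M) (net : shallow_net R M T W)
    (X : T.-tuple 'cV[R]_N) : R :=
  \sum_(r < W) sh_lambda net r *
    nary xi [tuple inner (f (tnth X t)) (sh_v net r t) | t < T].

(* Only the values at 0, ..., T are used. *)
Record rnn_ranks (T : nat) := RnnRanks {
  rk :> nat -> nat;
  rk_gt0 : forall t, (0 < rk t)%N;
  rk_first : rk 0%N = 1%N;
  rk_last : rk T = 1%N
}.

(* Time steps are numbered from 0: index t : 'I_T stands for step t + 1, so
   the core tensor at t has dimensions L x R_t x R_(t+1). *)
Record rnn (R : realType) (M T L : nat) (r : rnn_ranks T) := Rnn {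
  rnn_C : 'I_T -> 'M[R]_(L, M);
  rnn_G : forall t : 'I_T, 'I_L -> 'I_(r t) -> 'I_(r t.+1) -> R
}.
Arguments rnn_G {R M T L r} _ _ _ _ _.

Fixpoint rnn_hidden (R : realType) (xi : R -> R -> R) (u : R) (N M T L : nat)
    (r : rnn_ranks T) (f : 'cV[R]_N -> 'cV[R]_M) (net : rnn R M L r)
    (X : T.-tuple 'cV[R]_N) (t : nat) : (t <= T)%N -> 'I_(r t) -> R :=
  match t return (t <= T)%N -> 'I_(r t) -> R with
  | 0 => fun _ _ => u
  | t'.+1 => fun (lt_t'T : (t' < T)%N) k =>
      let s := Ordinal lt_t'T in
      \sum_(i < L) \sum_(j < r t')
        rnn_G net s i j k *
        xi ((rnn_C net s *m f (tnth X s)) i 0)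
           (rnn_hidden xi u f net X (ltnW lt_t'T) j)
  end.

Definition rnn_score (R : realType) (xi : R -> R -> R) (u : R) (N M T L : nat)
    (r : rnn_ranks T) (f : 'cV[R]_N -> 'cV[R]_M) (net : rnn R M L r)
    (X : T.-tuple 'cV[R]_N) : R :=
  rnn_hidden xi u f net X (leqnn T) (cast_ord (esym (rk_last r)) ord0).

(* Main.v *)
(** A parameter vector can prescribe the responses to the M templates
    arbitrarily, because F is invertible.  With 0/1 responses the maximum acts
    as a disjunction, and by De Morgan
    [delta_s(i) = 1 - max_t [i_t != s_t]], so the indicator of a multi-index s
    is a difference of two rank-one terms (1 being the maximum of constant
    responses 1).  The shallow network sums these indicators with weights H s.
    The RNN keeps in its t-th state the numbers [prefix != p], p ranging over
    all prefixes of length t, and adds them up with weights in the last step. *)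
Require Import Defs.
From HB Require Import structures.
From mathcomp Require Import all_boot all_order all_algebra.
From mathcomp Require Import reals.

Set Implicit Arguments.
Unset Strict Implicit.
Unset Printing Implicit Defensive.

Import Order.TTheory GRing.Theory Num.Theory.
Local Open Scope ring_scope.

(** The features of template [m] form row [m] of the feature matrix, which cancels against its
    inverse; so the columns of [A] are freely chosen response patterns. *)
Lemma feature_response (R : realType) (N M n : nat)
    (f : 'cV[R]_N -> 'cV[R]_M) (x : 'I_M -> 'cV[R]_N)
    (F_inv : feature_matrix f x \in unitmx) (A : 'M[R]_(M, n)) (m : 'I_M) :
  (f (x m))^T *m (invmx (feature_matrix f x) *m A) = row m A.
Proof.
have -> : (f (x m))^T = row m (feature_matrix f x).
  by apply/rowP => j; rewrite !mxE.
by rewrite mulmxA -!row_mul mulmxV // mul1mx.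
Qed.

Lemma relu_xi_bool (R : realType) (b c : bool) :
  @relu_xi R b%:R c%:R = (b || c)%:R.
Proof.
by case: b; case: c; rewrite /relu_xi ?maxxx // ?(max_l ler01) ?(max_r ler01)
  ?(max_l ler01).
Qed.

Lemma bigmax_bool (R : realType) (I : finType) (b : pred I) :
  \big[Num.max/0]_(i : I) (b i)%:R = [exists i, b i]%:R :> R.
Proof.
have -> : [exists i, b i] = has b (index_enum I).
  apply/existsP/hasP => [[i bi]|[i _ bi]]; last by exists i.
  by exists i => //; rewrite mem_index_enum.
elim: (index_enum I) => [|i s IH]; first by rewrite big_nil.
rewrite big_cons IH /=.
by case: (b i); case: (has b s);
  rewrite ?maxxx // ?(max_l ler01) ?(max_r ler01).
Qed.

Lemma nary_relu_xi_bool (R : realType) (T : nat) (T_ge2 : (2 <= T)%N)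
    (b : pred 'I_T) :
  nary (@relu_xi R) [tuple (b t)%:R | t < T] = [exists t, b t]%:R.
Proof.
by rewrite nary_relu_xi ?size_tuple // -bigmax_bool /= big_map enumT.
Qed.

Lemma shallow_universal (R : realType) (N M T : nat) (M_gt0 : (0 < M)%N)
    (T_ge2 : (2 <= T)%N) (f : 'cV[R]_N -> 'cV[R]_M) (x : 'I_M -> 'cV[R]_N)
    (F_inv : feature_matrix f x \in unitmx) (H : tensor R M T) :
  exists (W : nat) (net : shallow_net R M T W),
    (0 < W)%N /\ grid_tensor x (shallow_score (@relu_xi R) f net) = H.
Proof.
(* Two hidden units per multi-index: flag [true] gives constant responses 1, flag [false] the
   mismatch responses, with the opposite sign. *)
pose S := (T.-tuple 'I_M * bool)%type.
pose lam (s : S) := if s.2 then H s.1 else - H s.1.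
pose v (s : S) (t : 'I_T) : 'cV[R]_M := invmx (feature_matrix f x) *m
  \col_m (s.2 || (m != tnth s.1 t))%:R.
exists #|{: S}|, (ShallowNet (fun r => lam (enum_val r))
                             (fun r => v (enum_val r))); split.
  by apply/card_gt0P; exists ([tuple Ordinal M_gt0 | _ < T], true).
apply/ffunP => i; rewrite ffunE /shallow_score /=.
pose g (s : S) := lam s * [exists t, s.2 || (tnth i t != tnth s.1 t)]%:R.
transitivity (\sum_(s : S) g s).
  rewrite [RHS](reindex _ (onW_bij _ (@enum_val_bij {: S}))) /=.
  apply: eq_bigr => r _; congr (_ * _); rewrite -nary_relu_xi_bool //.
  congr (nary _ _); apply: eq_map => t; rewrite tnth_mktuple.
  by rewrite /inner feature_response // !mxE.
(* At [s = i] the mismatch term vanishes and [H i] remains; any other [s] differs from [i]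
   somewhere, so both maxima are 1 and the pair cancels. *)
rewrite -(pair_bigA _ (fun s b => g (s, b))) (bigD1 i) //= [X in _ + X]big1.
  rewrite addr0 big_bool /g /lam /=.
  have -> : [exists t : 'I_T, true].
    by apply/existsP; exists (Ordinal (ltnW T_ge2)).
  rewrite (_ : [exists t, _] = false) ?mulr1 ?mulr0 ?addr0 //.
  by apply/existsP => -[t]; rewrite eqxx.
move=> s ne_si; rewrite big_bool /g /lam /=.
have -> : [exists t : 'I_T, true].
  by apply/existsP; exists (Ordinal (ltnW T_ge2)).
suff -> : [exists t, tnth i t != tnth s t] by rewrite !mulr1 subrr.
apply: contraNT ne_si => /existsPn eq_is; apply/eqP/eq_from_tnth => t.
by have /negPn/eqP := eq_is t.
Qed.

(** Base-[M] numeral with the earliest letter leading: appending letter [i] to a prefix with code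
    [j] gives [j * M + i], so codes can index hidden states. *)
Fixpoint prefix_code (M : nat) (s : nat -> nat) (t : nat) : nat :=
  if t is t'.+1 then (prefix_code M s t' * M + s t')%N else 0%N.

Lemma eq_digits (M j j' i i' : nat) : (i < M)%N -> (i' < M)%N ->
  (j * M + i == j' * M + i')%N = (j == j') && (i == i').
Proof.
move=> ltiM lti'M; apply/eqP/andP => [e|[/eqP-> /eqP->]//].
have M_gt0 : (0 < M)%N by apply: leq_ltn_trans ltiM.
have := congr1 (divn^~ M) e; have := congr1 (modn^~ M) e.
by rewrite /= !modnMDl !divnMDl // !modn_small // !divn_small // !addn0 => -> ->.
Qed.

Lemma prefix_code_inj (M : nat) (s s' : nat -> nat) (t : nat) :
  (forall u, s u < M)%N -> (forall u, s' u < M)%N ->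
  prefix_code M s t = prefix_code M s' t ->
  forall u, (u < t)%N -> s u = s' u.
Proof.
move=> sM s'M; elim: t => //= t IH /eqP.
rewrite eq_digits // => /andP[/eqP/IH eq_s /eqP eq_st] u.
by rewrite ltnS leq_eqVlt => /predU1P[->|/eq_s].
Qed.

Section PrefixNetwork.
Variables (R : realType) (N M T : nat).
Hypothesis M_gt0 : (0 < M)%N.
Variables (f : 'cV[R]_N -> 'cV[R]_M) (x : 'I_M -> 'cV[R]_N).
Hypothesis F_inv : feature_matrix f x \in unitmx.
Variable H : tensor R M T.+1.

(** One state per prefix of length [t], until the last step collapses them to the scalar output. *)
Definition prefix_rank (t : nat) : nat := if (t < T.+1)%N then (M ^ t)%N else 1.

Lemma prefix_rank_gt0 t : (0 < prefix_rank t)%N.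
Proof. by rewrite /prefix_rank; case: ifP; rewrite // expn_gt0 M_gt0. Qed.

Lemma prefix_rank_last : prefix_rank T.+1 = 1%N.
Proof. by rewrite /prefix_rank ltnn. Qed.

Definition prefix_ranks : rnn_ranks T.+1 :=
  @RnnRanks T.+1 prefix_rank prefix_rank_gt0 erefl prefix_rank_last.

Definition digit (s : T.+1.-tuple 'I_M) (u : nat) : nat :=
  nth (Ordinal M_gt0) s u.

Lemma digit_lt s u : (digit s u < M)%N.
Proof. exact: ltn_ord. Qed.

(** The tensor read through codes. Codes of full multi-indices are injective, so at most one summand
    occurs and no decoding map is needed. *)
Definition weight (n : nat) : R :=
  \sum_(s | prefix_code M (digit s) T.+1 == n) H s.

Lemma weight_code s : weight (prefix_code M (digit s) T.+1) = H s.
Proof.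
rewrite /weight (bigD1 s) // big1 => [|s' /andP[/eqP eq_code]].
  exact: addr0.
case/eqP; apply: eq_from_tnth => t; apply: val_inj.
rewrite !(tnth_nth (Ordinal M_gt0)).
exact: prefix_code_inj (digit_lt s') (digit_lt s) eq_code _ (ltn_ord t).
Qed.

(* Row i < M responds to template m with [m != i]; the additional row M
   responds with 1 to all templates. *)
Definition prefix_C : 'M[R]_(M.+1, M) :=
  (invmx (feature_matrix f x) *m \matrix_(m < M, i < M.+1) (m != i :> nat)%:R)^T.

Lemma prefix_C_response (m : 'I_M) (i : 'I_M.+1) :
  (prefix_C *m f (x m)) i 0 = (m != i :> nat)%:R.
Proof.
by rewrite -[f (x m)]trmxK -trmx_mul feature_response // !mxE.
Qed.

(** Before the last step, state [k] only reads the pair with [j * M + i = k]. In the last step the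
    constant row supplies the 1 in [1 - mismatch] for every pair at once, hence its summed
    weight. *)
Definition prefix_G (t : 'I_T.+1) (i : 'I_M.+1) (j : 'I_(prefix_rank t))
    (k : 'I_(prefix_rank t.+1)) : R :=
  if (t < T)%N then ((i < M)%N && (j * M + i == k)%N)%:R
  else if (i < M)%N then - weight (j * M + i)
  else \sum_(m < M) weight (j * M + m).

Definition prefix_net : rnn R M M.+1 prefix_ranks :=
  @Rnn R M T.+1 M.+1 prefix_ranks (fun=> prefix_C) prefix_G.

Variable s : T.+1.-tuple 'I_M.
Let X := [tuple x (tnth s t) | t < T.+1].

Lemma prefix_C_step (t : 'I_T.+1) (i : 'I_M.+1) :
  (prefix_C *m f (tnth X t)) i 0 = (digit s t != i)%:R.
Proof.
by rewrite tnth_mktuple prefix_C_response (tnth_nth (Ordinal M_gt0)).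
Qed.

Lemma prefix_hidden t (le_tT : (t <= T.+1)%N) (k : 'I_(prefix_rank t)) :
  (t < T.+1)%N ->
  rnn_hidden (@relu_xi R) 0 f prefix_net X le_tT k =
  (prefix_code M (digit s) t != k)%:R.
Proof.
elim: t le_tT k => [|t IH] le_tT k lt_tT.
  (* The only state is 0, the code of the empty prefix, so the mismatch indicator is the initial
     value 0. *)
  by case: k => -[].
have lt_k : (k < M ^ t.+1)%N.
  by have := ltn_ord k; rewrite {2}/prefix_rank lt_tT.
have lt_j : (k %/ M < prefix_rank t)%N.
  by rewrite /prefix_rank le_tT ltn_divLR // -expnSr.
rewrite /= big_ord_recr /= [X in _ + X]big1 ?addr0; last first.
  by move=> j _; rewrite /prefix_G /= -ltnS lt_tT ltnn mul0r.
(* Division by [M] splits [k] into its last letter [k %% M] and the prefix code [k %/ M], the only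
   pair with a nonzero coefficient. *)
rewrite (bigD1 (Ordinal (ltn_pmod k M_gt0))) //= [X in _ + X]big1 ?addr0.
  rewrite (bigD1 (Ordinal lt_j)) //= [X in _ + X]big1 ?addr0.
    rewrite /prefix_G /= -ltnS lt_tT ltn_pmod // -divn_eq eqxx mul1r.
    rewrite IH // prefix_C_step relu_xi_bool /=.
    by rewrite [in RHS](divn_eq k M) eq_digits ?digit_lt ?ltn_pmod // negb_and orbC.
  move=> j ne_j; rewrite /prefix_G /= -ltnS lt_tT ltn_pmod //=.
  rewrite [in X in _ == X](divn_eq k M) eq_digits ?ltn_pmod //.
  by rewrite -(inj_eq val_inj) /= in ne_j; rewrite (negPf ne_j) mul0r.
move=> i ne_i; apply: big1 => j _; rewrite /prefix_G /= -ltnS lt_tT ltn_ord /=.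
rewrite [in X in _ == X](divn_eq k M) eq_digits ?ltn_pmod //.
by rewrite -(inj_eq val_inj) /= in ne_i; rewrite (negPf ne_i) andbF mul0r.
Qed.

Lemma prefix_net_score : rnn_score (@relu_xi R) 0 f prefix_net X = H s.
Proof.
rewrite -weight_code /rnn_score /=.
set c := prefix_code M _ _.
have lt_c : (c < prefix_rank T)%N.
  rewrite /prefix_rank ltnSn /c; elim: T => //= t IH.
  rewrite expnSr; apply: (@leq_trans ((prefix_code M (digit s) t).+1 * M)).
    by rewrite mulSn addnC ltn_add2r digit_lt.
  by rewrite leq_mul2r IH orbT.
under eq_bigr => i _ do under eq_bigr => j _ do
  rewrite prefix_hidden // prefix_C_step relu_xi_bool /prefix_G /= ltnn.
rewrite exchange_big /=.
(* For each pair, [weight] from the constant row plus [- weight] times the mismatch leaves [weight]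
   exactly when prefix and letter both match. *)
transitivity (\sum_(j < prefix_rank T) \sum_(m < M)
    if (c == j) && (digit s T == m) then weight (j * M + m) else 0).
  apply: eq_bigr => j _; rewrite big_ord_recr /= ltnn (ltn_eqF (digit_lt s T)) mulr1.
  rewrite -big_split /=; apply: eq_bigr => m _; rewrite ltn_ord.
  by case: eqP; case: eqP => //= _ _; rewrite ?mulr0 ?mulr1 ?add0r ?addNr.
rewrite (bigD1 (Ordinal lt_c)) //= [X in _ + X]big1 ?addr0; last first.
  move=> j ne_j; apply: big1 => m _.
  by rewrite -(inj_eq val_inj) /= eq_sym in ne_j; rewrite (negPf ne_j).
rewrite eqxx -big_mkcond (big_pred1 (Ordinal (digit_lt s T))) // => m.
by rewrite eq_sym; apply: (inj_eq val_inj m).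
Qed.

End PrefixNetwork.

Theorem theorem5p1 (R : realType) (N M T : nat)
    (N_gt0 : (0 < N)%N) (M_gt0 : (0 < M)%N) (T_ge2 : (2 <= T)%N)
    (f : 'cV[R]_N -> 'cV[R]_M) (x : 'I_M -> 'cV[R]_N)
    (F_inv : feature_matrix f x \in unitmx)
    (H : tensor R M T) :
  (exists (W : nat) (net : shallow_net R M T W),
      (0 < W)%N /\
      grid_tensor x (shallow_score (@relu_xi R) f net) = H) /\
  (exists (L : nat) (r : rnn_ranks T) (net : rnn R M L r),
      (0 < L)%N /\
      grid_tensor x (rnn_score (@relu_xi R) 0 f net) = H).
Proof.
split; first exact: shallow_universal.
case: T T_ge2 H => // T _ H.
exists M.+1, (prefix_ranks T M_gt0), (prefix_net M_gt0 f x H); split => //.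
by apply/ffunP => s; rewrite ffunE prefix_net_score.
Qed.
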